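(* Let $(x_{i,j})_{(i,j)\in I}$ be a regular array in a Banach space $X$, $(M_j)_{j\in\mathbb{N}}\subseteq\mathbb{N}$ be an increasing sequence of integers and $\varepsilon>0$. Then there exists a regular subarray $(y_{i,j})_{(i,j)\in I}$ of $(x_{i,j})_{(i,j)\in I}$ such that for any finitely supported scalars $(a_{i,j})_{(i,j)\in I}$, any $k_0\in\mathbb{N}$ and any $F\subseteq\mathbb{N}$ with $|F|\le M_{\min(F)}$ and $k_0\le\min(F)$ we have $$\Big\|\sum_{(i,j)\in I}a_{i,j}y_{i,j}\Big\|\ \ge\ \frac1{2+\varepsilon}\Big\|\sum_{j\in F}a_{k_0,j}y_{k_0,j}\Big\|.$$
   Context: $I=\{(i,j)\in\mathbb{N}\times\mathbb{N}: i\le j\}$. The reverse lexicographic order $<_{r\ell}$ on $\mathbb{N}^2$: $(i,j)<_{r\ell}(i',j')$ iff $j<j'$, or $j=j'$ and $i<i'$. Regular array: a family $(x_{i,j})_{(i,j)\in I}$ of vectors in $X$ such that for each $i$ the row $(x_{i,j})_{j\ge i}$ is a seminormalized weakly null sequence, and the whole family is a basic sequence when ordered by $<_{r\ell}$: $x_{1,1},x_{1,2},x_{2,2},x_{1,3},x_{2,3},x_{3,3},x_{1,4},\dots$. Subarray: $(y_{i,j})_{(i,j)\in I}$, itself an array (each row $(y_{i,j})_{j\ge i}$ seminormalized and weakly null), is a subarray of $(x_{i,j})_{(i,j)\in I}$ if $\{y_{i,j}:j\ge i\}\subseteq\{x_{i,j}:j\ge i\}$ for every $i$, and there is a $<_{r\ell}$-order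 preserving map $H:I\to I$ with $y_{i,j}=x_{H(i,j)}$ for all $(i,j)\in I$. *)

(* Defs.v *)
From HB Require Import structures.
From mathcomp Require Import all_boot all_order all_algebra.
From mathcomp Require Import finmap zify.
From mathcomp Require Import all_classical all_reals all_analysis.

Set Implicit Arguments.
Unset Strict Implicit.
Unset Printing Implicit Defensive.

Import Order.TTheory GRing.Theory Num.Theory.
Import numFieldNormedType.Exports.

Local Open Scope classical_set_scope.
Local Open Scope ring_scope.

(* Indices start at 0.  A family indexed by [array_index] is a total function
   on nat * nat whose values at (i, j) with j < i are never looked at. *)
Definition array_index : set (nat * nat) := [set p | (p.1 <= p.2)%N].

Definition rl_lt (p q : nat * nat) : bool :=
  (p.2 < q.2)%N || (p.2 == q.2) && (p.1 < q.1)%N.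

Definition rl_succ (p : nat * nat) : nat * nat :=
  if (p.1 < p.2)%N then (p.1.+1, p.2) else (0%N, p.2.+1).

(* (0,0), (0,1), (1,1), (0,2), (1,2), (2,2), (0,3), ... ; the next lemmas show
   that this is the increasing enumeration of [array_index] for [rl_lt]. *)
Definition rl_enum (n : nat) : nat * nat := iter n rl_succ (0%N, 0%N).

Lemma rl_enum_index n : array_index (rl_enum n).
Proof.
elim: n => [//|n IHn]; rewrite /array_index /rl_enum /= -/(rl_enum n) /rl_succ.
by case: ifP.
Qed.

Lemma rl_lt_trans : transitive rl_lt.
Proof. by move=> [a b] [c d] [e f]; rewrite /rl_lt /=; lia. Qed.

Lemma rl_enum_lt m n : (m < n)%N -> rl_lt (rl_enum m) (rl_enum n).
Proof.
have step k : rl_lt (rl_enum k) (rl_enum k.+1).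
  rewrite /rl_enum /= -/(rl_enum k) /rl_succ /rl_lt; case: ifP => /= h; lia.
elim: n => [//|n IHn]; rewrite ltnS leq_eqVlt => /predU1P[->|/IHn h].
  exact: step.
exact: rl_lt_trans h (step n).
Qed.

Lemma rl_enum_surj p : array_index p -> exists n, rl_enum n = p.
Proof.
case: p => i j; rewrite /array_index /=; elim: j i => [|j IHj].
  by case=> // _; exists 0%N.
elim=> [|i IHi] le_ij.
  have [n e_n] := IHj j (leqnn j).
  by exists n.+1; rewrite /rl_enum /= -/(rl_enum n) e_n /rl_succ /= ltnn.
have [n e_n] := IHi (ltnW le_ij).
by exists n.+1; rewrite /rl_enum /= -/(rl_enum n) e_n /rl_succ /= le_ij.
Qed.

Section Arrays.
Context {R : realType} {X : completeNormedModType R}.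
Implicit Types (u : nat -> X) (x y : nat * nat -> X).

Definition seminormalized u : Prop :=
  exists c C : R, 0 < c /\ forall n, c <= `|u n| <= C.

Definition weakly_null u : Prop :=
  forall f : {linear X -> R^o}, continuous f ->
    f (u n) @[n --> \oo] --> (0 : R^o).

Definition linear_span u : set X :=
  [set v | exists (n : nat) (c : nat -> R), v = \sum_(k < n) c k *: u k].

(* [u] is a Schauder basis of its closed linear span. *)
Definition basic_sequence u : Prop :=
  forall v : X, closure (linear_span u) v ->
    exists! a : nat -> R, series (fun k => a k *: u k) @ \oo --> v.

Definition array_row x (i : nat) : nat -> X := fun n => x (i, (i + n)%N).

Definition is_array x : Prop :=
  forall i, seminormalized (array_row x i) /\ weakly_null (array_row x i).

Definition regular_array x : Prop :=
  is_array x /\ basic_sequence (fun n => x (rl_enum n)).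

Definition subarray x y : Prop :=
  [/\ is_array y,
      forall i, [set y (i, j) | j in [set j | (i <= j)%N]]
                  `<=` [set x (i, j) | j in [set j | (i <= j)%N]] &
      exists H : nat * nat -> nat * nat,
        [/\ forall p, array_index p -> array_index (H p),
            forall p q, array_index p -> array_index q ->
              rl_lt p q -> rl_lt (H p) (H q) &
            forall p, array_index p -> y p = x (H p)]].

End Arrays.

Definition is_min (F : {fset nat}) (m : nat) : Prop :=
  m \in F /\ forall j, j \in F -> (m <= j)%N.

(* Main.v *)
Require Import Defs.
From HB Require Import structures.
From mathcomp Require Import all_boot all_order all_algebra.
From mathcomp Require Import finmap zify ring lra.
From mathcomp Require Import all_classical all_reals all_analysis.

(** Since the rows are weakly null, columns can be chosen so far out that the
    following holds for the chosen vectors [y_t], listed in the reverse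
    lexicographic order. Whenever [f] is in the dual unit ball, and [A] is a
    set of few positions from [t0] on, all in the row of [t0], some [g] in the
    dual unit ball almost agrees with [f] on the [y_t] with [t] in [A] and is
    almost zero on all the other [y_t] with [t0 <= t] up to any given bound
    ([pattern_transfer]). If moreover the [y_t] have basis constant close to 1,
    then the part of a finite sum [v] that comes before [t0] can be removed at
    the cost of a factor close to 2, and testing the rest against the [g] that
    comes from a norming functional [f] of the [A]-part of [v] bounds that part
    by nearly [2 * |v|] ([restricted_sum_le]). The errors stay small because
    the basis constant controls each coefficient by the norm of [v].

    The heart is how to find the columns. Fix a non-principal ultrafilter [U]
    on the column numbers. Call a set [S] of functionals, together with a list
    [p_1], ..., [p_k] of constraints still to be placed in columns, realizable
    when for [U]-most [n_1], for [U]-most [n_2], and so on, some [f] in [S] and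
    the dual ball satisfies each [p_i] at column [n_i]. If such a promise holds
    then the iterated [U]-limit [f] of the witnesses is a single functional
    such that the promise survives the extra demand that the witnesses be close
    to [f] at any one prescribed vector ([realizable_limit]). As [f] tends to
    zero along each row, the promise survives the demand to be small at a
    vector far enough in that row ([realizable_vanish]). On the other hand,
    because [U] is an ultrafilter, the truth value of a promise does not change
    when its first constraint is placed in a [U]-typical column
    ([realizable_cons]). The values of functionals on a bounded row can be
    rounded to a finite grid, so at each step only finitely many promises
    matter, and one column is typical for all of them; it can also be made
    typical for Mazur's construction of basic sequences ([mazur_step]).

    With columns chosen in this way, an [f] that takes a pattern of values on
    the positions of [A] makes the pattern a true promise at time [t0], by
    going backwards over the positions; going forwards, the promise is kept
    while requiring smallness at every position outside [A].

    Norming functionals come from the Hahn-Banach theorem, proved here by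
    finding minimal sublinear functionals. A sequence of nonzero vectors with
    uniformly bounded partial sum operators is basic (Grunblum's criterion), so the
    chosen subarray is regular. *)

Set Implicit Arguments.
Unset Strict Implicit.
Unset Printing Implicit Defensive.

Import Order.TTheory GRing.Theory Num.Theory.
Import numFieldNormedType.Exports.

Local Open Scope classical_set_scope.
Local Open Scope ring_scope.

(** * The Hahn-Banach theorem *)

Section HahnBanach.
Context {R : realType} {V : lmodType R}.
Implicit Types (p q f : V -> R) (u v w : V).

(** Only one inequality is asked for positive scalars: applied to [c] and to
    its inverse it gives equality, and for [u = 0] it gives [p 0 = 0]. *)
Definition sublinear p : Prop :=
  (forall u v, p (u + v) <= p u + p v) /\
  (forall c u, 0 < c -> p (c *: u) <= c * p u).

Lemma sublinear0 p : sublinear p -> p 0 = 0.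
Proof.
move=> [pD pZ]; have := pD 0 0; have := pZ 2^-1 0 (ltac:(lra)).
rewrite scaler0 addr0; lra.
Qed.

Lemma sublinearZ p c u : sublinear p -> 0 <= c -> p (c *: u) = c * p u.
Proof.
move=> slp; rewrite le_eqVlt => /predU1P[<-|c_gt0].
  by rewrite scale0r mul0r sublinear0.
case: slp => _ pZ; apply/eqP; rewrite eq_le pZ //= -ler_pdivlMl //.
by rewrite -{1}[u](scalerK (lt0r_neq0 c_gt0)) pZ // invr_gt0.
Qed.

Lemma sublinear_geN p u : sublinear p -> - p (- u) <= p u.
Proof.
by move=> slp; have := slp.1 u (- u); rewrite subrr sublinear0//; lra.
Qed.

(** The functional [q u = inf_{t >= 0} (p (u + t v) - t p v)] tilts [p] so that
    it is odd at [v]. A minimal sublinear functional is therefore odd at every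
    point, hence linear; and tilting at [v] before minimizing keeps the value
    at [v] from dropping. *)
Lemma sublinear_reduce p v : sublinear p ->
  exists q, [/\ sublinear q, forall u, q u <= p u & q (- v) <= - p v].
Proof.
move=> slp; have [pD pZ] := slp.
pose E u := [set p (u + t *: v) - t * p v | t in [set t | 0 <= t]].
have Elb u : lbound (E u) (- p (- u)).
  move=> _ [t /= t_ge0 <-]; rewrite -(sublinearZ v slp t_ge0).
  by have := pD (u + t *: v) (- u); rewrite addrC addKr; lra.
have Ein u t : 0 <= t -> inf (E u) <= p (u + t *: v) - t * p v.
  by move=> t_ge0; apply: ge_inf; [exists (- p (- u))|exists t].
have E0 u : E u !=set0 by exists (p (u + 0 *: v) - 0 * p v), 0 => //=.
exists (fun u => inf (E u)); split; last first.
- by have := Ein (- v) 1 ler01; rewrite scale1r addNr sublinear0// mul1r sub0r.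
- by move=> u; have := Ein u 0 (lexx 0); rewrite scale0r mul0r addr0 subr0.
split=> [u w|c u c_gt0].
  suff key s t : 0 <= s -> 0 <= t -> inf (E (u + w)) <=
      (p (u + s *: v) - s * p v) + (p (w + t *: v) - t * p v).
    rewrite -lerBlDr; apply: lb_le_inf => // _ [s /= s0 <-].
    rewrite lerBlDr -lerBlDl; apply: lb_le_inf => // _ [t /= t0 <-].
    by rewrite lerBlDl; exact: key.
  move=> s0 t0; apply: (le_trans (Ein _ _ (addr_ge0 s0 t0))).
  have := pD (u + s *: v) (w + t *: v).
  by rewrite addrACA -scalerDl; lra.
rewrite -ler_pdivrMl //; apply: lb_le_inf => // _ [t /= t0 <-].
rewrite ler_pdivrMl //; have ct0 := mulr_ge0 (ltW c_gt0) t0.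
apply: (le_trans (Ein _ _ ct0)).
have := pZ c (u + t *: v) c_gt0.
by rewrite scalerDr scalerA; lra.
Qed.

(** Lower bounds of chains, for Zorn's lemma. All members lie above
    [u |-> - p (- u)], so the pointwise infimum is finite. *)
Lemma sublinear_inf (A : set (V -> R)) p :
  A !=set0 -> (forall q, A q -> sublinear q /\ (forall u, q u <= p u)) ->
  (forall q r, A q -> A r -> (forall u, q u <= r u) \/ (forall u, r u <= q u)) ->
  exists q, sublinear q /\ (forall r, A r -> forall u, q u <= r u).
Proof.
move=> [q0 Aq0] Asl Atot; pose E u := [set q u | q in A].
have E0 u : E u !=set0 by exists (q0 u), q0.
have Ein u q : A q -> inf (E u) <= q u.
  move=> Aq; apply: ge_inf; last by exists q.
  exists (- p (- u)) => _ [r /Asl[slr rp] <-].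
  by apply: le_trans (sublinear_geN u slr); rewrite lerN2.
exists (fun u => inf (E u)); split=> [|r Ar u]; last exact: Ein.
split=> [u w|c u c_gt0].
  suff key q r : A q -> A r -> inf (E (u + w)) <= q u + r w.
    rewrite -lerBlDr; apply: lb_le_inf => // _ [q /= Aq <-].
    rewrite lerBlDr -lerBlDl; apply: lb_le_inf => // _ [r /= Ar <-].
    by rewrite lerBlDl; exact: key.
  move=> Aq Ar; have [qr|rq] := Atot q r Aq Ar.
    apply: (le_trans (Ein _ _ Aq)); have := (Asl q Aq).1.1 u w.
    by have := qr w; lra.
  apply: (le_trans (Ein _ _ Ar)); have := (Asl r Ar).1.1 u w.
  by have := rq u; lra.
rewrite -ler_pdivrMl //; apply: lb_le_inf => // _ [q /= Aq <-].
rewrite ler_pdivrMl //; apply: (le_trans (Ein _ _ Aq)).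
exact: (Asl q Aq).1.2.
Qed.

Theorem hahn_banach p v : sublinear p ->
  exists f, [/\ forall a u w, f (a *: u + w) = a * f u + f w,
                forall u, f u <= p u & f v = p v].
Proof.
move=> slp; have [p1 [slp1 p1p p1v]] := sublinear_reduce v slp.
pose T := {q : V -> R | sublinear q /\ forall u, q u <= p1 u}.
pose below (q r : T) := `[< forall u, sval r u <= sval q u >].
(* Zorn's lemma finds maximal elements, so the order on [T] is reversed. *)
have [q qmin] : exists q : T, premaximal below q.
  apply: (ZL_preorder (exist _ p1 (conj slp1 (fun u => lexx _)) : T)).
  - by move=> q; apply/asboolP.
  - move=> r s t /asboolP sr /asboolP st; apply/asboolP => u.
    exact: le_trans (st u) (sr u).
  move=> A Atot; have [[q0 Aq0]|A0] := pselect (A !=set0); last first.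
    exists (exist _ p1 (conj slp1 (fun u => lexx _))) => q Aq.
    by case: A0; exists q.
  have [||q r|q [slq qA]] := @sublinear_inf (sval @` A) p1.
  - by exists (sval q0), q0.
  - by move=> _ [r _ <-]; exact: svalP r.
  - move=> [a Aa <-] [b Ab <-]; have [/asboolP ab|/asboolP ba] := Atot a b Aa Ab.
      by right.
    by left.
  have qp1 u : q u <= p1 u.
    have := qA (sval q0) (ex_intro2 _ _ q0 Aq0 erefl) u.
    by move/le_trans; apply; exact: (svalP q0).2.
  exists (exist _ q (conj slq qp1)) => r Ar; apply/asboolP => u /=.
  by apply: qA; exists r.
case: q qmin => q [slq qp1] qmin.
(* By minimality the tilt of [q] at [u] is [q] itself. *)
have qN u : q (- u) = - q u.
  have [r [slr rq ru]] := sublinear_reduce u slq.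
  have rp1 w : r w <= p1 w by exact: le_trans (rq w) (qp1 w).
  have := qmin (exist _ r (conj slr rp1)) (introT (asboolP _) rq).
  move/asboolP => /= qr; apply/eqP; rewrite eq_le (le_trans (qr _) ru) /=.
  by have := sublinear_geN u slq; lra.
have qD u w : q (u + w) = q u + q w.
  apply/eqP; rewrite eq_le slq.1 /=.
  by have := slq.1 (- u) (- w); rewrite -opprD !qN; lra.
have qZ a u : q (a *: u) = a * q u.
  have [a0|a0] := leP 0 a; first exact: sublinearZ.
  rewrite -[a *: u]opprK -scaleNr qN (sublinearZ _ slq) ?mulNr ?opprK//.
  by rewrite oppr_ge0 ltW.
exists q; split=> [a u w|u|]; first by rewrite qD qZ.
  exact: le_trans (qp1 u) (p1p u).
apply/eqP; rewrite eq_le (le_trans (qp1 v) (p1p v)) /=.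
by have := le_trans (qp1 (- v)) p1v; rewrite qN lerN2.
Qed.

End HahnBanach.

(** * The dual unit ball and limits along an ultrafilter *)

Section DualBall.
Context {R : realType} {X : normedModType R}.
Implicit Types (f g : X -> R).

(** The members are plain functions, so that pointwise limits of them can be
    taken without building continuous linear maps first. *)
Definition dual_ball : set (X -> R) :=
  [set f | (forall a u v, f (a *: u + v) = a * f u + f v) /\
           forall u, `|f u| <= `|u|].

Lemma dual_ball_ge0 f u : dual_ball f -> f u <= `|u|.
Proof. by move=> [_ fu]; exact: le_trans (ler_norm _) (fu u). Qed.

Lemma dual_ball_sum f (c : nat -> R) (y : nat -> X) (s : seq nat) :
  dual_ball f -> f (\sum_(i <- s) c i *: y i) = \sum_(i <- s) c i * f (y i).
Proof.
move=> [flin _].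
have f0 : f 0 = 0 by have := flin 1 0 0; rewrite scaler0 addr0; lra.
by elim: s => [|i s IHs]; rewrite ?big_nil// !big_cons flin IHs.
Qed.

Lemma norming_functional u : exists2 f, dual_ball f & f u = `|u|.
Proof.
have slN : sublinear (fun v : X => `|v|).
  split=> [v w|c v c0]; first exact: ler_normD.
  by rewrite normrZ gtr0_norm.
have [f [flin fle fu]] := hahn_banach u slN.
exists f => //; split=> // v; rewrite ler_norml fle andbT lerNl.
have := flin (-1) v 0; rewrite addr0 scaleN1r.
have := flin 1 0 0; rewrite scaler0 addr0 => f00 fN.
by have := fle (- v); rewrite normrN; lra.
Qed.

(** Weak convergence is tested on bundled continuous linear maps; members of
    the dual ball are of this kind. *)
Lemma dual_ball_weakly_null (u : nat -> X) f : 
  (forall g : {linear X -> R^o}, continuous g ->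
    g (u n) @[n --> \oo] --> (0 : R^o)) ->
  dual_ball f -> f (u n) @[n --> \oo] --> 0.
Proof.
move=> u0 [flin fb].
have flin' : linear (f : X -> R^o) by move=> a v w; rewrite flin.
pose g : {linear X -> R^o} := HB.pack (f : X -> R^o)
  (GRing.isLinear.Build R X R^o _ f flin').
apply: (u0 g) => x; apply: (@bounded_linear_continuous _ _ _ g).
apply/linear_boundedP.
near=> r => v; apply: (le_trans (fb v)).
rewrite -[leLHS]mul1r ler_wpM2r//; near: r; exact: nbhs_pinfty_ge.
Unshelve. all: by end_near. Qed.

End DualBall.

Section UltraLimit.
Context {R : realType} (U : set_system nat) {UU : UltraFilter U}.

Lemma bounded_ultra_cvg (a : nat -> R) (C : R) :
  (\forall n \near U, `|a n| <= C) -> exists l : R, a n @[n --> U] --> l.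
Proof.
move=> aC.
have cK : compact (`[(- C), C]%classic : set R) by exact: segment_compact.
have /cK [] : (a @ U) `[(- C), C]%classic.
  by apply: filterS aC => n; rewrite /= in_itv /= -ler_norml.
move=> l [_ lcl]; exists l => A lA.
have [//|nA] := in_ultra_setVsetC (a @^-1` A) UU.
by have [w []] := lcl (~` A) A nA lA.
Qed.

Lemma near_ultraN (P : nat -> Prop) :
  ~ (\forall n \near U, P n) -> \forall n \near U, ~ P n.
Proof. by move=> nP; have [|] := in_ultra_setVsetC [set n | P n] UU. Qed.

Context {X : normedModType R}.

(** Weak-star compactness of the dual ball, in the only form used below:
    bounded scalars have a limit along [U], and pointwise limits inherit
    linearity and the norm bound. *)
Lemma dual_ball_ultra_limit (f : nat -> X -> R) :
  (forall n, dual_ball (f n)) ->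
  exists2 g, dual_ball g & forall u, f n u @[n --> U] --> g u.
Proof.
move=> fb.
have /choice[g fg] u : exists l : R, f n u @[n --> U] --> l.
  by apply: (@bounded_ultra_cvg _ `|u|); apply: nearW => n; exact: (fb n).2.
exists g => //; split=> [a u v|u].
  have lim : f n (a *: u + v) @[n --> U] --> a * g u + g v.
    rewrite (_ : (fun n => _) = (fun n => a * f n u + f n v)); last first.
      by apply/funext => n; rewrite (fb n).1.
    by apply: cvgD => //; apply: cvgM => //; exact: cvg_cst.
  exact: (cvg_unique _ (fg (a *: u + v)) lim).
rewrite leNgt; apply/negP => ug.
have [n] := @filter_ex _ U _ _ (cvgr_gt _ (cvg_norm (fg u)) _ ug).
by rewrite ltNge (fb n).2.
Qed.

Lemma cvg_linear_combination (y : nat -> X) (t : nat)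
    (c : nat -> nat -> R) (l : nat -> R) :
  (forall j, (j < t)%N -> c n j @[n --> U] --> l j) ->
  \sum_(0 <= j < t) c n j *: y j @[n --> U] --> \sum_(0 <= j < t) l j *: y j.
Proof.
elim: t => [|t IHt] cl.
  rewrite big_geq // (_ : (fun _ => _) = fun=> 0); first exact: cvg_cst.
  by apply/funext => n; rewrite big_geq.
rewrite big_nat_recr//= (_ : (fun _ => _) = fun n =>
    \sum_(0 <= j < t) c n j *: y j + c n t *: y t); last first.
  by apply/funext => n; rewrite big_nat_recr.
apply: cvgD; first by apply: IHt => j jt; apply: cl; exact: ltnW.
exact: cvgZr_tmp (cl t (ltnSn t)).
Qed.

Lemma dual_ball_cvg (f : X -> R) (v : nat -> X) (l : X) : dual_ball f ->
  v n @[n --> U] --> l -> f (v n) @[n --> U] --> f l.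
Proof.
move=> [flin fb] /cvgrPdist_lt vl; apply/cvgrPdist_lt => e /vl.
apply: filterS => n; apply: le_lt_trans.
have := fb (-1 *: v n + l); rewrite flin.
by rewrite mulN1r addrC scaleN1r addrC [l - _]addrC.
Qed.

End UltraLimit.

(** * Bounded partial sums and basic sequences *)

Section PartialSums.
Context {R : realType} {X : normedModType R}.
Implicit Types (y : nat -> X) (c w : nat -> R) (K : R).

(** Stopping at [N] allows the property to be used while the sequence is still
    being constructed. *)
Definition partial_sums_bounded y K N : Prop := forall c m n,
  (m <= n)%N -> (n <= N)%N ->
  `|\sum_(0 <= j < m) c j *: y j| <= K * `|\sum_(0 <= j < n) c j *: y j|.

(** A sequence is built one vector at a time, each step losing a factor
    [w t.+1 / w t] close to 1. Weights between 1 and [K] keep the product of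
    these factors below [K] without any infinite product. *)
Lemma weighted_partial_sums y w K N :
  (forall t, 1 <= w t <= K) ->
  (forall c t, (t < N)%N -> w t * `|\sum_(0 <= j < t) c j *: y j|
     <= w t.+1 * `|\sum_(0 <= j < t.+1) c j *: y j|) ->
  partial_sums_bounded y K N.
Proof.
move=> w1 step c m n mn nN.
have mono : w m * `|\sum_(0 <= j < m) c j *: y j|
     <= w n * `|\sum_(0 <= j < n) c j *: y j|.
  elim: n mn nN => [|n IHn]; first by rewrite leqn0 => /eqP->.
  rewrite leq_eqVlt => /predU1P[->//|mn] nN.
  by apply: le_trans (step c n nN); apply: IHn => //; exact: ltnW.
have /andP[wm _] := w1 m; have /andP[_ wn] := w1 n.
apply: le_trans (ler_wpM2r _ wn) => //; apply: le_trans mono.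
by rewrite ler_peMl.
Qed.

(** A term of the sum is a difference of two consecutive partial sums. *)
Lemma coef_le_partial_sums y K N c i n : partial_sums_bounded y K N ->
  (i < n)%N -> (n <= N)%N ->
  `|c i| * `|y i| <= 2 * K * `|\sum_(0 <= j < n) c j *: y j|.
Proof.
move=> yK i_n nN; rewrite -normrZ.
have -> : c i *: y i =
    \sum_(0 <= j < i.+1) c j *: y j - \sum_(0 <= j < i) c j *: y j.
  by rewrite big_nat_recr//= addrAC subrr add0r.
have := ler_normB (\sum_(0 <= j < i.+1) c j *: y j)
  (\sum_(0 <= j < i) c j *: y j).
have := yK c _ _ i_n nN; have := yK c _ _ (ltnW i_n) nN.
lra.
Qed.

End PartialSums.

Section Grunblum.
Context {R : realType} {X : completeNormedModType R}.
Implicit Types (u : nat -> X) (K : R).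

Lemma linear_combinationB u (a b : nat -> R) n :
  \sum_(0 <= j < n) (a j - b j) *: u j =
  \sum_(0 <= j < n) a j *: u j - \sum_(0 <= j < n) b j *: u j.
Proof. by rewrite -sumrB; apply: eq_bigr => j _; rewrite scalerBl. Qed.

Lemma partial_sums_coef_unique u K (a b : nat -> R) (v : X) :
  (forall N, partial_sums_bounded u K N) -> (forall n, u n != 0) ->
  series (fun k => a k *: u k) @ \oo --> v ->
  series (fun k => b k *: u k) @ \oo --> v -> a = b.
Proof.
move=> uK u0 av bv; apply/funext => i; apply/eqP; rewrite -subr_eq0.
pose d k := a k - b k.
have dv : \sum_(0 <= j < n) d j *: u j @[n --> \oo] --> (0 : X).
  have -> : (fun n => \sum_(0 <= j < n) d j *: u j) =
      series (fun k => a k *: u k) \- series (fun k => b k *: u k).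
    by apply/funext => n; rewrite linear_combinationB.
  by rewrite -(subrr v); exact: cvgB.
have di0 : `|d i| * `|u i| <= 0.
  rewrite leNgt; apply/negP => dui.
  have K1 : 0 < `|2 * K| + 1 by rewrite ltr_wpDl.
  have e0 : 0 < `|d i| * `|u i| / (`|2 * K| + 1) by rewrite divr_gt0.
  have [n [/= dn i_n]] := @filter_ex _ \oo _ _ (filterI
    (cvgr0_norm_lt _ dv _ e0) (nbhs_infty_gt i)).
  have := coef_le_partial_sums d (uK n) i_n (leqnn n).
  move: dn; rewrite ltr_pdivlMr// => dn.
  have := ler_norm (2 * K) =>
    /(ler_wpM2r (normr_ge0 (\sum_(0 <= j < n) d j *: u j))).
  have := normr_ge0 (\sum_(0 <= j < n) d j *: u j); nra.
by move: di0; by rewrite -normrZ normr_le0 scaler_eq0 (negPf (u0 i)) orbF.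
Qed.

(** Grunblum's criterion. A point [v] of the closed span is a limit of finite
    combinations, whose coefficients are bounded index by index; their limits
    along an ultrafilter are the coefficients of [v], since the partial sum
    operators are uniformly bounded and those of the approximations are
    eventually stationary. *)
Lemma basic_sequence_of_partial_sums u K : 0 <= K ->
  (forall N, partial_sums_bounded u K N) -> (forall n, u n != 0) ->
  basic_sequence u.
Proof.
move=> K0 uK u0 v vcl.
suff [a av] : exists a : nat -> R, series (fun k => a k *: u k) @ \oo --> v.
  by exists a; split=> // b; exact: partial_sums_coef_unique.
have [U [UU ooU]] := ultraFilterLemma (F := \oo : set_system nat) _.
pose e k : R := k.+1%:R^-1.
(* [(cn k).1] holds the coefficients of the [k]-th approximation, extended by
   zero from [(cn k).2] on, so that all its later partial sums are equal. *)
have /choice[cn cnP] k : exists cn : (nat -> R) * nat, forall N, (cn.2 <= N)%N ->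
    `|v - \sum_(0 <= j < N) cn.1 j *: u j| < e k.
  have ek : 0 < e k by rewrite invr_gt0.
  have [w [[n [c ->]]]] := vcl _ (nbhsx_ballx v _ ek).
  rewrite -ball_normE /= => vw.
  exists (fun j => if (j < n)%N then c j else 0, n) => N /= nN.
  rewrite (big_cat_nat (leq0n n) nN)//=.
  rewrite [X in _ - (_ + X)]big_nat_cond [X in _ - (_ + X)]big1 ?addr0.
    rewrite (_ : \sum_(0 <= j < n) _ = \sum_(j < n) c j *: u j)//.
    by rewrite big_mkord; apply: eq_bigr => j _; rewrite ltn_ord.
  by move=> j /andP[/andP[nj _] _]; rewrite ltnNge nj scale0r.
pose c k := (cn k).1; pose n k := (cn k).2.
have e1 k : e k <= 1 by rewrite invf_le1 ?ler1n.
have cK k l N : `|\sum_(0 <= j < N) (c k j - c l j) *: u j| <= K * (e k + e l).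
  pose N' := maxn N (maxn (n k) (n l)).
  apply: (le_trans (uK N' _ N N' _ _)) => //; first exact: leq_maxl.
  apply: ler_wpM2l => //.
  have kN : (n k <= N')%N by rewrite !leq_max leqnn orbT.
  have lN : (n l <= N')%N by rewrite !leq_max leqnn !orbT.
  have hk := ltW (cnP k N' kN); have hl := ltW (cnP l N' lN).
  rewrite linear_combinationB -[X in X - _](subrK v) -addrA.
  by apply: le_trans (ler_normD _ _) _; rewrite distrC lerD.
have /choice[a aP] i : exists a : R, c k i @[k --> U] --> a.
  apply: (@bounded_ultra_cvg _ U _ _ ((2 * K * (`|v| + 1)) / `|u i|)).
  apply: nearW => k; rewrite ler_pdivlMr ?normr_gt0//.
  pose N' := maxn i.+1 (n k).
  apply: le_trans (coef_le_partial_sums (c k) (uK N') (_ : (i < N')%N) (leqnn _)) _.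
    exact: leq_maxl.
  apply: ler_wpM2l; first by rewrite mulr_ge0.
  have kN : (n k <= N')%N by rewrite leq_maxr.
  have h := ltW (cnP k N' kN).
  have := ler_normB v (v - \sum_(0 <= j < N') c k j *: u j).
  rewrite opprB addrC subrK; have := e1 k; rewrite /c; lra.
exists a; apply/cvgrPdist_lt => eps eps0.
have K1 : 0 < 1 + 2 * K by lra.
have [k kP] : exists k, e k < eps / (1 + 2 * K).
  have e'0 : 0 < eps / (1 + 2 * K) by rewrite divr_gt0.
  have [k _ kP] := near_infty_natSinv_lt (PosNum e'0).
  by exists k; exact: (kP k (leqnn k)).
near=> N.
have /cvgrPdist_lt lim : \sum_(0 <= j < N) c l j *: u j @[l --> U] -->
    \sum_(0 <= j < N) a j *: u j.
  exact: cvg_linear_combination.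
(* [v] is within [e k] of the approximation [k], whose [N]-th partial sum is
   within [K (e k + e l)] of that of a later approximation [l], and the latter
   is within [gap] of the [N]-th partial sum of the limit. *)
have gap : 0 < eps - (1 + 2 * K) * e k.
  by rewrite subr_gt0 mulrC -ltr_pdivlMr.
have [l [/= al kl]] := @filter_ex _ U _ _ (filterI (lim _ gap)
  (ooU _ (nbhs_infty_ge k))).
have el : e l <= e k by rewrite lef_pV2 ?posrE// ler_nat.
have vk : `|v - \sum_(0 <= j < N) c k j *: u j| < e k.
  by apply: cnP; near: N; exact: nbhs_infty_ge.
have := ler_normD (v - \sum_(0 <= j < N) c k j *: u j)
  (\sum_(0 <= j < N) c k j *: u j - \sum_(0 <= j < N) c l j *: u j).
rewrite addrA subrK => h1.
have := ler_normD (v - \sum_(0 <= j < N) c l j *: u j)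
  (\sum_(0 <= j < N) c l j *: u j - \sum_(0 <= j < N) a j *: u j).
rewrite addrA subrK (distrC (\sum_(0 <= j < N) c l j *: u j)) => h2.
have h3 := cK k l N; rewrite linear_combinationB in h3.
have := ler_wpM2l K0 el.
rewrite /series /=; lra.
Unshelve. all: by end_near. Qed.

End Grunblum.

(** * Mazur's construction *)

Section Mazur.
Context {R : realType} {X : normedModType R}.
Context (U : set_system nat) {UU : UltraFilter U}.

(** For a fixed vector [v], a norming functional of [v] is almost zero at [u n]
    for large [n], hence [|v + a u_n|] is almost at least [|v|] when [a] is
    bounded, and large [a] only help. Uniformity over the span comes from compactness: normalized
    counterexamples for [U]-most [n] have bounded coefficients, and the limit
    of their first parts along [U] would be a unit vector whose norming
    functional contradicts the estimate. *)
Lemma mazur_step (y : nat -> X) (t : nat) (u : nat -> X)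
    (w w' c0 : R) (D : nat -> R) :
  0 < w -> w < w' -> 0 < c0 -> (forall n, c0 <= `|u n|) ->
  (forall c i, (i < t)%N -> `|c i| <= D i * `|\sum_(0 <= j < t) c j *: y j|) ->
  (forall f, dual_ball f -> f (u n) @[n --> U] --> 0) ->
  \forall n \near U, forall (c : nat -> R) (a : R),
    w * `|\sum_(0 <= j < t) c j *: y j|
      <= w' * `|\sum_(0 <= j < t) c j *: y j + a *: u n|.
Proof.
move=> w0 ww' c00 uc cD u0; have w'0 : 0 < w' by exact: lt_trans ww'.
pose Q n := forall (c : nat -> R) (a : R), w * `|\sum_(0 <= j < t) c j *: y j|
  <= w' * `|\sum_(0 <= j < t) c j *: y j + a *: u n|.
have [//|bad] := @in_ultra_setVsetC _ U [set n | Q n] UU.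
have /choice[ca caP] n : exists ca : (nat -> R) * R,
    ~ Q n ->
    let S := \sum_(0 <= j < t) ca.1 j *: y j in
    [/\ `|S| = 1, `|ca.2| <= 2 / c0 & `|S + ca.2 *: u n| < w / w'].
  have [q|] := pselect (Q n); first by exists (fun=> 0, 0) => /(_ q).
  move=> /existsNP[c /existsNP[a /negP]]; rewrite -ltNge.
  set S := \sum_(0 <= j < t) _ => lt.
  have Sgt0 : 0 < `|S|.
    rewrite normr_gt0; apply: contraTneq lt => ->.
    by rewrite normr0 mulr0 -leNgt mulr_ge0// ltW.
  exists (fun j => `|S|^-1 * c j, `|S|^-1 * a) => _ /=.
  have -> : \sum_(0 <= j < t) (`|S|^-1 * c j) *: y j = `|S|^-1 *: S.
    by rewrite scaler_sumr; apply: eq_bigr => j _; rewrite scalerA.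
  set a' := `|S|^-1 * a; have S1 : `| `|S|^-1 *: S| = 1.
    by rewrite normrZ gtr0_norm ?invr_gt0// mulVf ?gt_eqF.
  have lt' : `| `|S|^-1 *: S + a' *: u n| < w / w'.
    rewrite -scalerA -scalerDr normrZ gtr0_norm ?invr_gt0//.
    by rewrite ltr_pdivrMl// mulrA ltr_pdivlMr// mulrC (mulrC `|S|).
  clearbody a'; split=> //; rewrite ler_pdivlMr//.
  apply: (@le_trans _ _ `|a' *: u n|).
    by rewrite normrZ ler_wpM2l.
  have := ler_normB (`|S|^-1 *: S + a' *: u n) (`|S|^-1 *: S).
  have : w / w' < 1 by rewrite ltr_pdivrMr// mul1r.
  by rewrite addrAC subrr add0r; lra.
pose S n := \sum_(0 <= j < t) (ca n).1 j *: y j.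
have good : \forall n \near U, [/\ `|S n| = 1, `|(ca n).2| <= 2 / c0 &
    `|S n + (ca n).2 *: u n| < w / w'] by apply: filterS bad => n /caP.
have /choice[c cP] j : exists c : R,
    (j < t)%N -> (ca n).1 j @[n --> U] --> c.
  have [jt|_] := boolP (j < t)%N; last by exists 0.
  suff /bounded_ultra_cvg[c cP] : \forall n \near U, `|(ca n).1 j| <= D j.
    by exists c.
  apply: filterS good => n [S1 _ _]; have := cD (ca n).1 _ jt.
  by rewrite -/(S n) S1 mulr1.
pose S0 := \sum_(0 <= j < t) c j *: y j.
have SS0 : S n @[n --> U] --> S0.
  exact: (cvg_linear_combination (c := fun n => (ca n).1)).
have [f fb fS0] := norming_functional S0.
have S01 : `|S0| = 1.
  have S1 : `|S n| @[n --> U] --> (1 : R).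
    by apply: cvg_near_cst; apply: filterS good => n [].
  exact: (cvg_unique _ (cvg_norm SS0) S1).
have fSu : f (S n + (ca n).2 *: u n) @[n --> U] --> (1 : R).
  rewrite (_ : (fun n => _) = (fun n => (ca n).2 * f (u n) + f (S n))); last first.
    by apply/funext => n; rewrite addrC fb.1.
  rewrite -[1]add0r -S01 -fS0; apply: cvgD; last exact: dual_ball_cvg.
  apply/cvgr0Pnorm_lt => e e0.
  have e'0 : 0 < e * (c0 / 2) by rewrite mulr_gt0// divr_gt0.
  have := u0 _ fb => /cvgr0Pnorm_lt/(_ _ e'0).
  apply: filterS2 good => n [_ an _] fun_.
  rewrite normrM; apply: (@le_lt_trans _ _ (2 / c0 * `|f (u n)|)).
    by rewrite ler_wpM2r.
  by rewrite -ltr_pdivlMl ?divr_gt0// invf_div mulrC.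
have ww'1 : w / w' < 1 by rewrite ltr_pdivrMr// mul1r.
have [n [[_ _ Sn] fSn]] :=
  @filter_ex _ U _ _ (filterI good (cvgr_gt _ fSu _ ww'1)).
by have := le_lt_trans (dual_ball_ge0 _ fb) Sn; rewrite ltNge (ltW fSn).
Qed.

End Mazur.

(** * Promises about generic columns *)

Section Realizable.
Context {R : realType} {X : normedModType R}.
Context (U : set_system nat) {UU : UltraFilter U}.
Let D := X -> R.
Implicit Types (S : set D) (ph : seq (nat -> set D)).

(** The constraint [p n] is the set of functionals that obey it when it is
    placed in column [n]. The nested quantifiers choose the column of an
    earlier constraint before those of the later ones. *)
Fixpoint realizable S ph : Prop :=
  if ph is p :: ph' then \forall n \near U, realizable (S `&` p n) ph'
  else (S `&` dual_ball) !=set0.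

Lemma realizable_sub S S' ph : S `<=` S' -> realizable S ph -> realizable S' ph.
Proof.
elim: ph S S' => [|p ph IHph] S S' SS' /=.
  by move=> [f [Sf fb]]; exists f; split=> //; exact: SS'.
by apply: filterS => n; apply: IHph; exact: setSI.
Qed.

(** The functional [f] is the iterated limit along [U], innermost column first,
    of witnesses. Witnesses that come late in this limit are close to [f] at
    any given vector [v], although one witness need not serve all [v]. *)
Lemma realizable_limit S ph : realizable S ph ->
  exists2 f, dual_ball f & forall v e, 0 < e ->
    realizable (S `&` [set g | `|g v - f v| < e]) ph.
Proof.
elim: ph S => [|p ph IHph] S /=.
  move=> [f [Sf fb]]; exists f => // v e e0.
  by exists f; split=> //; split=> //=; rewrite subrr normr0.
move=> SU.
have /choice[f fP] n : exists f, dual_ball f /\ (realizable (S `&` p n) ph ->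
    forall v e, 0 < e ->
    realizable (S `&` p n `&` [set g | `|g v - f v| < e]) ph).
  have [/IHph[f fb fP]|nr] := pselect (realizable (S `&` p n) ph); first by exists f.
  have [f fb _] := norming_functional (0 : X).
  by exists f; split.
have [|g gb fg] := dual_ball_ultra_limit (f := f).
  by move=> n; exact: (fP n).1.
exists g => // v e e0; have e2 : 0 < e / 2 by rewrite divr_gt0.
have := fg v => /cvgrPdist_lt/(_ _ e2); apply: filterS2 SU => n SU gf.
apply: realizable_sub ((fP n).2 SU v _ e2) => h [[Sh ph_h] /= hf].
split=> //; split=> //=.
have := ler_normD (h v - f n v) (f n v - g v); rewrite addrA subrK.
by rewrite (distrC (f n v)); lra.
Qed.

(** This is where weak nullity enters: the limit functional is small at [u n]
    for large [n], so witnesses close to it there are small as well. *)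
Lemma realizable_vanish (u : nat -> X) S ph e :
  (forall f, dual_ball f -> f (u n) @[n --> U] --> 0) -> 0 < e ->
  realizable S ph ->
  \forall n \near U, realizable (S `&` [set g | `|g (u n)| <= e]) ph.
Proof.
move=> u0 e0 /realizable_limit[f fb fP].
have e2 : 0 < e / 2 by rewrite divr_gt0.
have := u0 _ fb => /cvgr0Pnorm_lt/(_ _ e2); apply: filterS => n fn.
apply: realizable_sub (fP (u n) _ e2) => h [Sh /= hf]; split=> //=.
have := ler_normD (h (u n) - f (u n)) (f (u n)); rewrite subrK; lra.
Qed.

(** A false promise stays false at typical columns because the complement of a
    set outside an ultrafilter belongs to it. *)
Lemma realizable_cons S p ph : \forall n \near U,
  realizable S (p :: ph) <-> realizable (S `&` p n) ph.
Proof.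
have [yes|no] := pselect (realizable S (p :: ph)).
  by apply: (filterS _ yes) => n rn; split.
have := @near_ultraN U UU (fun n => realizable (S `&` p n) ph) no.
by apply: filterS => n nr; split.
Qed.

End Realizable.

(** * Choosing the columns *)

(** Histories are total functions of which only a prefix counts; this is what
    the locality hypothesis says. *)
Lemma dependent_choice_prefix (P : (nat -> nat) -> nat -> nat -> Prop) :
  (forall l l' t n, (forall s, (s < t)%N -> l s = l' s) -> P l t n -> P l' t n) ->
  (forall l t, (forall s, (s < t)%N -> P l s (l s)) -> exists n, P l t n) ->
  exists l, forall t, P l t (l t).
Proof.
move=> Ploc Pex.
have /choice[nx nxP] (lt : (nat -> nat) * nat) : exists n,
    (forall s, (s < lt.2)%N -> P lt.1 s (lt.1 s)) -> P lt.1 lt.2 n.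
  have [/Pex[n Pn]|no] := pselect (forall s, (s < lt.2)%N -> P lt.1 s (lt.1 s)).
    by exists n.
  by exists 0%N.
pose L := fix L t := if t is t'.+1
  then fun s => if s == t' then nx (L t', t') else L t' s else fun=> 0%N.
pose l t := L t.+1 t.
have Ll t s : (s < t)%N -> L t s = l s.
  elim: t => // t IHt; rewrite ltnS leq_eqVlt => /predU1P[->//|st] /=.
  by rewrite ltn_eqF// IHt.
exists l; elim/ltn_ind => t IHt.
rewrite {2}/l /= eqxx; apply: (Ploc (L t)); first exact: Ll.
apply: (nxP (L t, t)) => s /= st; rewrite Ll//; apply: Ploc (IHt s st) => s' s's.
by rewrite Ll// (ltn_trans s's).
Qed.

Lemma near_finite_set (T : Type) (U : set_system nat) (A : set T)
    (Q : T -> nat -> Prop) :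
  Filter U -> finite_set A -> (forall a, A a -> \forall n \near U, Q a n) ->
  \forall n \near U, forall a, A a -> Q a n.
Proof.
move=> UF /(@finite_fsetP {classic T})[B AB] AQ.
have := @filter_bigI _ {classic T} B (fun a => [set n | Q a n]) U UF.
rewrite AB in AQ *; move=> /(_ AQ); apply: filterS => n QB a Ba; exact: QB.
Qed.

Section Selection.
Context {R : realType} {X : normedModType R}.
Context (U : set_system nat) {UU : UltraFilter U}.
Context (z : nat -> nat -> X) (r : nat -> nat) (eta : nat -> R).
Let D := X -> R.
Let state := (set D * seq (nat -> set D))%type.
Context (start : nat -> set state).
Implicit Types (l : nat -> nat) (st : state).

(** A state is a promise: the functionals still allowed, and the constraints
    not yet placed. At time [t], when column [n] of row [r t] has been chosen,
    a promise may be left alone, or be strengthened by smallness at the new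
    vector, or have its first constraint placed in column [n]. *)
Definition vanish_at t n st : state :=
  (st.1 `&` [set g | `|g (z (r t) n)| <= eta t], st.2).

Definition fulfil_at n st : state :=
  (st.1 `&` head (fun=> setT) st.2 n, behead st.2).

(** All promises that can arise by time [t] from those which start at some
    time up to [t]. When finitely many start at each time, these are finitely
    many, and a generic column suits them all. *)
Fixpoint tracked l t : set state :=
  if t is t'.+1
  then start t `|` (tracked l t' `|` (vanish_at t' (l t') @` tracked l t' `|`
                    fulfil_at (l t') @` tracked l t'))
  else start 0%N.

Lemma start_tracked l t : start t `<=` tracked l t.
Proof. by case: t => [//|t] s; left. Qed.

Lemma finite_tracked l t :
  (forall t, finite_set (start t)) -> finite_set (tracked l t).
Proof.
move=> fin; elim: t => [|t IHt] /=; first exact: fin.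
by rewrite !finite_setU; do ![split] => //; exact: finite_image.
Qed.

Lemma eq_tracked l l' t :
  (forall s, (s < t)%N -> l s = l' s) -> tracked l t = tracked l' t.
Proof.
elim: t => //= t IHt ll'; rewrite IHt => [|s st]; last exact/ll'/ltnW.
by rewrite ll'.
Qed.

(** The equivalence is used in both directions: from right to left to see that
    a pattern taken by an actual functional was promised at its start, and from
    left to right to keep that promise. *)
Definition respects_tracked l t n : Prop := forall st, tracked l t st ->
  (realizable U st.1 st.2 -> realizable U (vanish_at t n st).1 st.2) /\
  (realizable U st.1 st.2 <->
   realizable U (fulfil_at n st).1 (fulfil_at n st).2).

Lemma near_respects_tracked l t :
  (forall t, finite_set (start t)) -> 0 < eta t ->
  (forall f, dual_ball f -> f (z (r t) n) @[n --> U] --> 0) ->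
  \forall n \near U, respects_tracked l t n.
Proof.
move=> fin eta0 z0; apply: near_finite_set; first exact: finite_tracked.
move=> [S ph] _; apply: filterI.
  have [/(realizable_vanish z0 eta0)|nr] := pselect (realizable U S ph).
    by apply: filterS.
  by apply: nearW.
case: ph => [|p ph]; first by apply: nearW => n; rewrite /= setIT.
exact: realizable_cons.
Qed.

(** The bounds [b] let the caller ask that the columns grow fast enough. *)
Lemma selection (c : nat -> R) (b : nat -> nat -> nat) (K : R) :
  \oo `<=` U -> 1 < K ->
  (forall t, 0 < eta t) -> (forall t, finite_set (start t)) ->
  (forall i, 0 < c i) -> (forall i n, c i <= `|z i n|) ->
  (forall i f, dual_ball f -> f (z i n) @[n --> U] --> 0) ->
  exists l, [/\ forall t, (b t (l t) <= l t.+1)%N,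
    forall N, partial_sums_bounded (fun t => z (r t) (l t)) K N &
    forall t, respects_tracked l t (l t)].
Proof.
move=> ooU K1 eta0 fin c0 cz z0.
(* Any strictly increasing weights in [1, K] will do. *)
pose w t : R := K - (K - 1) / t.+1%:R.
have w1K t : 1 <= w t <= K.
  have t1 : 1 <= t.+1%:R :> R by rewrite ler1n.
  have : 0 <= (K - 1) / t.+1%:R by rewrite divr_ge0 ?subr_ge0 ?ltW.
  have : (K - 1) / t.+1%:R <= K - 1.
    by rewrite ler_pdivrMr ?ltr0n// ler_peMr// subr_ge0 ltW.
  by rewrite /w; move: (_ / _) => q q1 q0; apply/andP; split; lra.
have wlt t : w t < w t.+1.
  by rewrite ltrD2l ltrN2 ltr_pM2l ?subr_gt0// ltf_pV2 ?posrE// ltr_nat.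
pose B l t n : bool := if t is t'.+1 then (b t' (l t') <= n)%N else true.
pose P l t n := [/\ B l t n,
  forall a x, w t * `|\sum_(0 <= j < t) a j *: z (r j) (l j)|
    <= w t.+1 * `|\sum_(0 <= j < t) a j *: z (r j) (l j) + x *: z (r t) n| &
  respects_tracked l t n].
have Psums l N : (forall t, (t < N)%N -> P l t (l t)) ->
    partial_sums_bounded (fun t => z (r t) (l t)) K N.
  move=> Pl; apply: (weighted_partial_sums w1K) => a t tN.
  by have [_ /(_ a (a t)) + _] := Pl t tN; rewrite big_nat_recr.
have [l l' t n ll' []|l t IHl|l Pl] := @dependent_choice_prefix P.
- move=> bl wl rl; split.
  + by case: t ll' bl {wl rl} => // t ll'; rewrite /B ll'.
  + move=> a x; have := wl a x.
    have -> // : \sum_(0 <= j < t) a j *: z (r j) (l j) =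
        \sum_(0 <= j < t) a j *: z (r j) (l' j).
    by apply: eq_big_nat => j /andP[_ /ll'->].
  + by move=> st; rewrite -(eq_tracked ll'); exact: rl.
- have h1 : \forall n \near U, B l t n.
    case: t {IHl} => [|t]; first exact: nearW.
    by apply: ooU; exact: nbhs_infty_ge.
  have h2 : \forall n \near U, forall a x,
    w t * `|\sum_(0 <= j < t) a j *: z (r j) (l j)|
    <= w t.+1 * `|\sum_(0 <= j < t) a j *: z (r j) (l j) + x *: z (r t) n|.
    have w0 : 0 < w t by have /andP[] := w1K t; lra.
    apply: (mazur_step (D := fun i => 2 * K / c (r i)) w0 (wlt t) (c0 (r t))) => //.
      move=> a i it; rewrite mulrAC ler_pdivlMr//.
      apply: le_trans (coef_le_partial_sums a (Psums l t IHl) it (leqnn t)).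
      by rewrite ler_wpM2l.
    exact: z0.
  have h3 := near_respects_tracked l fin (eta0 t) (z0 (r t)).
  suff : \forall n \near U, P l t n by exact: filter_ex.
  by apply: filterS3 h1 h2 h3 => n *; split.
exists l; split=> [t|N|t]; last by have [] := Pl t.
  by have [] := Pl t.+1.
by apply: Psums => t _.
Qed.

End Selection.

(** * Moving a functional off all but few positions *)

(** The patterns tracked from a starting time are words over its grid, so this
    keeps the set of promises finite. *)
Lemma finite_words (T : choiceType) (s : seq T) (n : nat) :
  finite_set [set w : seq T | (size w <= n)%N /\ {subset w <= s}].
Proof.
elim: n => [|n IHn].
  apply: (@sub_finite_set _ _ [set [::]]) => // w /= [].
  by rewrite leqn0 size_eq0 => /eqP.
apply: (@sub_finite_set _ _ ([set [::]] `|` [set x :: w | x in [set` s] & w in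
    [set w : seq T | (size w <= n)%N /\ {subset w <= s}]])).
  move=> [|x w] /= [wn ws]; [by left|right].
  exists x; first by apply: ws; rewrite mem_head.
  by exists w => //; split=> // v vw; apply: ws; rewrite inE vw orbT.
rewrite finite_setU; split; first exact: finite_set1.
by apply: finite_image2.
Qed.

(** The grid consists of the points [i d - C] for [i <= 2 C / d]. *)
Lemma finite_grid (R : realType) (C d : R) : 0 < d ->
  exists s : seq R, forall v, `|v| <= C -> exists2 a, a \in s & `|v - a| <= d.
Proof.
move=> d0; exists [seq i%:R * d - C | i <- iota 0 (Num.truncn ((C + C) / d)).+1].
move=> v; rewrite ler_norml => /andP[Cv vC].
have vd0 : 0 <= (v + C) / d by apply: divr_ge0; [lra|exact: ltW].
exists ((Num.truncn ((v + C) / d))%:R * d - C).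
  apply: (map_f (fun i : nat => i%:R * d - C)); rewrite mem_iota /= add0n ltnS.
  by apply: le_truncn; rewrite ler_pM2r ?invr_gt0// lerD2r.
have := truncn_itv vd0; move: (Num.truncn _) => k /andP[].
rewrite ler_pdivlMr// ltr_pdivrMr// -natr1 mulrDl mul1r.
by rewrite ler_norml; move: (_%:R * d) => q h1 h2; apply/andP; split; lra.
Qed.

Section Transfer.
Context {R : realType} {X : normedModType R}.
Context (U : set_system nat) {UU : UltraFilter U}.
Context (z : nat -> nat -> X) (r M : nat -> nat) (eta delta C : nat -> R).
Context (grid : nat -> seq R).

(** The row is that of the starting time [t], while [n] is the column in which
    the value [a] is to be taken. *)
Definition near_value t (a : R) : nat -> set (X -> R) :=
  fun n => [set g | `|g (z (r t) n) - a| <= delta t].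

Definition patterns t : set (set (X -> R) * seq (nat -> set (X -> R))) :=
  [set (setT, [seq near_value t a | a <- s]) | s in
     [set s : seq R | (size s <= M t)%N /\ {subset s <= grid t}]].

Lemma finite_patterns t : finite_set (patterns t).
Proof. exact/finite_image/finite_words. Qed.

(** Rounding the values of [f] on [A] to the grid gives a pattern [ph]. At the
    end of the interval all its constraints are placed and [f] is a witness, so
    the pattern was a true promise at [t0]. From there the promise is kept while
    each position outside [A] asks for smallness, and the last witness is [g].
    Rounding costs one [delta], and realizing the pattern another. *)
Lemma pattern_transfer l f t0 N (A : pred nat) :
  (forall i n, `|z i n| <= C i) ->
  (forall t v, `|v| <= C (r t) -> exists2 a, a \in grid t & `|v - a| <= delta t) ->
  (forall t, respects_tracked U z r eta patterns l t (l t)) ->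
  dual_ball f ->
  (forall t, (t0 <= t)%N -> A t -> r t = r t0) ->
  (size [seq t <- iota t0 (N - t0) | A t] <= M t0)%N ->
  exists2 g, dual_ball g & forall t, (t0 <= t < N)%N ->
    if A t then `|g (z (r t) (l t)) - f (z (r t) (l t))| <= 2 * delta t0
    else `|g (z (r t) (l t))| <= eta t.
Proof.
move=> zC gridP resp fb Ar AM; pose y t := z (r t) (l t).
have /choice[a aP] t : exists a, (t0 <= t)%N -> A t ->
    a \in grid t0 /\ `|f (y t) - a| <= delta t0.
  have [[tt0 At]|] := pselect ((t0 <= t)%N /\ A t); last first.
    by move=> no; exists 0 => tt0 At; case: no.
  have [|b bg fyb] := gridP t0 (f (y t)); last by exists b.
  by apply: (le_trans (fb.2 _)); rewrite /y Ar.
pose ph t d := [seq near_value t0 (a s) | s <- iota t d & A s].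
have phS t d : ph t d.+1 =
    if A t then near_value t0 (a t) :: ph t.+1 d else ph t.+1 d.
  by rewrite /ph /=; case: (A t).
(* Outside [A] the promise is left alone, as [f] need not be small there. *)
have back d t S : (t0 <= t)%N -> tracked z r eta patterns l t (S, ph t d) -> S f ->
    realizable U S (ph t d).
  elim: d t S => [|d IHd] t S t0t trk Sf; first by exists f.
  move: trk; rewrite phS; case: ifP => At trk.
    apply/(resp t _ trk).2; apply: IHd; first exact: leqW.
      by right; right; right; exists (S, near_value t0 (a t) :: ph t.+1 d).
    split=> //=; have [_] := aP t t0t At.
    by rewrite /near_value /= /y Ar.
  by apply: IHd => //; [exact: leqW|right; left].
(* The same walk, now strengthening the promise outside [A]. *)
have forth d t S : (t0 <= t)%N -> tracked z r eta patterns l t (S, ph t d) ->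
    realizable U S (ph t d) -> exists2 g, dual_ball g /\ S g &
    forall s, (t <= s < t + d)%N ->
      if A s then `|g (y s) - a s| <= delta t0 else `|g (y s)| <= eta s.
  elim: d t S => [|d IHd] t S t0t.
    move=> _ [g [Sg gb]]; exists g => // s.
    by rewrite addn0 => /andP[ts /(leq_ltn_trans ts)]; rewrite ltnn.
  rewrite phS; case: ifP => At trk real.
    have [|||g [gb [Sg gt]] gP] := IHd t.+1 (S `&` near_value t0 (a t) (l t)).
    - exact: leqW.
    - by right; right; right; exists (S, near_value t0 (a t) :: ph t.+1 d).
    - exact/(resp t _ trk).2.
    exists g => // s; rewrite leq_eqVlt => /andP[/predU1P[<- _|ts sd]].
      by rewrite At; move: gt; rewrite /near_value /= /y Ar.
    by apply: gP; rewrite ts addSnnS.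
  have [|||g [gb [Sg gt]] gP] := IHd t.+1 (S `&` [set g | `|g (y t)| <= eta t]).
  - exact: leqW.
  - by right; right; left; exists (S, ph t.+1 d).
  - exact: (resp t _ trk).1 real.
  exists g => // s; rewrite leq_eqVlt => /andP[/predU1P[<- _|ts sd]].
    by rewrite At; exact: gt.
  by apply: gP; rewrite ts addSnnS.
have start : tracked z r eta patterns l t0 (setT, ph t0 (N - t0)%N).
  apply: start_tracked; exists [seq a s | s <- iota t0 (N - t0) & A s].
    split; first by rewrite size_map.
    move=> _ /mapP[s + ->]; rewrite mem_filter mem_iota => /andP[As /andP[ts _]].
    by have [] := aP s ts As.
  by rewrite /ph -map_comp.
have [g [gb _] gP] := forth _ _ _ (leqnn t0) start (back _ _ _ (leqnn t0) start I).
exists g => // t /andP[t0t tN]; have := gP t; rewrite subnKC; last first.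
  exact: ltnW (leq_ltn_trans t0t tN).
rewrite t0t tN => /(_ isT); case: ifP => // At gat; have [_] := aP t t0t At.
have := ler_normD (g (y t) - a t) (a t - f (y t)); rewrite addrA subrK.
by rewrite (distrC (a t)) -/(y t); lra.
Qed.

End Transfer.

(** * The norm of a restricted sum *)

Lemma sum_half_powers (R : realFieldType) (m n : nat) :
  \sum_(m <= t < n) (2^-1 : R) ^+ t.+1 <= 1.
Proof.
have [mn|nm] := leqP m n; last by rewrite big_geq ?ler01// ltnW.
rewrite (eq_bigr (fun t => (- (2^-1 : R) ^+ t.+1) - (- (2^-1) ^+ t))).
  rewrite telescope_sumr// opprK.
  have : (2^-1 : R) ^+ m <= 1 by rewrite exprn_ile1 ?invr_ge0// invf_le1// ler1n.
  have : 0 <= (2^-1 : R) ^+ n by rewrite exprn_ge0// invr_ge0.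
  by lra.
by move=> t _; rewrite exprS; lra.
Qed.

Section SchreierProjection.
Context {R : realType} {X : normedModType R}.

(** The constant is the bound [1 + K] for the projection to the positions from
    [t0] on, plus [eps] for the error of [g] on [A] and [eps] for its error off
    [A]. Each coefficient satisfies [|a t| * cy t <= 2 K |v|], where [v] is the
    full sum; this explains the bounds on [delta] and [eta]: the first error is
    shared by at most [B] positions, the second is summed against powers of
    [1/2]. *)
Lemma restricted_sum_le (y : nat -> X) (a : nat -> R) (A : pred nat)
    (t0 N B : nat) (K eps : R) (cy eta : nat -> R) (delta : R) :
  1 <= K -> 0 < eps ->
  (forall n, partial_sums_bounded y K n) ->
  (forall t, 0 < cy t <= `|y t|) ->
  (forall t, (t0 <= t)%N -> A t -> delta <= eps * cy t / (4 * K * B.+1%:R)) ->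
  (forall t, eta t <= eps * cy t / (2 * K) * 2^-1 ^+ t.+1) ->
  (size [seq t <- iota t0 (N - t0) | A t] <= B)%N ->
  (forall f, dual_ball f -> exists2 g, dual_ball g & forall t, (t0 <= t < N)%N ->
    if A t then `|g (y t) - f (y t)| <= 2 * delta else `|g (y t)| <= eta t) ->
  `|\sum_(t0 <= t < N | A t) a t *: y t|
    <= (1 + K + 2 * eps) * `|\sum_(0 <= t < N) a t *: y t|.
Proof.
move=> K1 eps0 yK cyP deltaP etaP AB transfer.
set nu := `|\sum_(0 <= t < N) a t *: y t|.
have nu0 : 0 <= nu by exact: normr_ge0.
have [Nt0|t0N] := leqP N t0.
  rewrite big_geq// normr0 mulr_ge0//; lra.
have K0 : 0 < K by lra.
have B0 : 0 < B.+1%:R :> R by [].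
have coef t : (t < N)%N -> `|a t| * cy t <= 2 * K * nu.
  move=> tN; apply: le_trans (coef_le_partial_sums a (yK N) tN (leqnn N)).
  by apply: ler_wpM2l => //; case/andP: (cyP t).
have tail : `|\sum_(t0 <= t < N) a t *: y t| <= (1 + K) * nu.
  have := big_cat_nat (leq0n t0) (ltnW t0N) (op := +%R)
    (P := predT) (F := fun t => a t *: y t).
  move=> /= eqs.
  have -> : \sum_(t0 <= t < N) a t *: y t =
      \sum_(0 <= t < N) a t *: y t - \sum_(0 <= t < t0) a t *: y t.
    by rewrite eqs addrAC subrr add0r.
  apply: le_trans (ler_normB _ _) _.
  have := yK N a t0 N (ltnW t0N) (leqnn N); rewrite -/nu; lra.
have [f fb <-] := norming_functional (\sum_(t0 <= t < N | A t) a t *: y t).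
have [g gb gP] := transfer f fb.
have gtail := le_trans (dual_ball_ge0 (\sum_(t0 <= t < N) a t *: y t) gb) tail.
rewrite -big_filter dual_ball_sum// big_filter.
rewrite dual_ball_sum// in gtail.
suff : \sum_(t0 <= t < N | A t) a t * f (y t) - \sum_(t0 <= t < N) a t * g (y t)
    <= 2 * eps * nu by lra.
rewrite big_mkcond -sumrB big_nat.
pose hit t := if A t then eps * nu / B.+1%:R else 0.
pose miss t := eps * nu * 2^-1 ^+ t.+1.
have miss0 t : 0 <= miss t.
  by apply: mulr_ge0; [exact: mulr_ge0 (ltW eps0) nu0|rewrite exprn_ge0// invr_ge0].
apply: (@le_trans _ _ (\sum_(t0 <= t < N) (hit t + miss t))).
  rewrite [leRHS]big_nat; apply: ler_sum => t /andP[t0t tN].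
  have := gP t; rewrite t0t tN => /(_ isT).
  have := coef t tN; have /andP[cy0 _] := cyP t.
  rewrite /hit; case: ifP => At at_ gt.
    apply: (@le_trans _ _ (eps * nu / B.+1%:R)); last by rewrite lerDl.
    rewrite -mulrBr; apply: le_trans (ler_norm _) _; rewrite normrM distrC.
    apply: (@le_trans _ _ (`|a t| * (2 * (eps * cy t / (4 * K * B.+1%:R))))).
      by rewrite ler_wpM2l// (le_trans gt)// ler_wpM2l// deltaP.
    rewrite (_ : _ * _ = `|a t| * cy t * (eps / (2 * K * B.+1%:R))); last first.
      by move: (B.+1%:R : R) B0 => b b0; field; rewrite !gt_eqF.
    rewrite (_ : eps * nu / B.+1%:R = 2 * K * nu * (eps / (2 * K * B.+1%:R)));
      last first.
      by move: (B.+1%:R : R) B0 => b b0; field; rewrite !gt_eqF.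
    by rewrite ler_wpM2r// divr_ge0 ?mulr_ge0 ?ltW.
  rewrite !add0r; apply: le_trans (ler_norm _) _; rewrite normrN normrM.
  apply: (@le_trans _ _ (`|a t| * (eps * cy t / (2 * K) * 2^-1 ^+ t.+1))).
    by rewrite ler_wpM2l// (le_trans gt).
  rewrite (_ : _ * _ = `|a t| * cy t * (eps / (2 * K) * 2^-1 ^+ t.+1)); last first.
    by field; rewrite gt_eqF.
  rewrite (_ : miss t = 2 * K * nu * (eps / (2 * K) * 2^-1 ^+ t.+1)); last first.
    by rewrite /miss; field; rewrite gt_eqF.
  by rewrite ler_wpM2r// mulr_ge0 ?exprn_ge0 ?invr_ge0// divr_ge0 ?mulr_ge0 ?ltW.
rewrite big_split /= -[2]/(1 + 1) mulrDl mul1r mulrDl lerD//.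
  rewrite /hit -big_mkcond -big_filter big_const_seq count_predT iter_addr_0.
  rewrite -[_ *+ _]mulr_natr mulrAC ler_pdivrMr//.
  apply: ler_wpM2l; first exact: mulr_ge0 (ltW eps0) nu0.
  by rewrite ler_nat leqW.
rewrite /miss -mulr_sumr -[leRHS]mulr1.
apply: ler_wpM2l; first exact: mulr_ge0 (ltW eps0) nu0.
exact: sum_half_powers.
Qed.

(** The form of the result that does not mention arrays: the vectors come from
    sequences [z i], and [r t] says from which one the [t]-th vector is taken. *)
Theorem schreier_selection (z : nat -> nat -> X) (r B : nat -> nat)
    (b : nat -> nat -> nat) (c C : nat -> R) (eps : R) : 0 < eps ->
  (forall i, 0 < c i) -> (forall i n, c i <= `|z i n| <= C i) ->
  (forall i f, dual_ball f -> f (z i n) @[n --> \oo] --> 0) ->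
  exists l (K : R), let y t := z (r t) (l t) in
  [/\ forall t, (b t (l t) <= l t.+1)%N, 0 <= K,
      forall N, partial_sums_bounded y K N &
      forall a t0 N (A : pred nat),
        (forall t, (t0 <= t)%N -> A t -> r t = r t0) ->
        (size [seq t <- iota t0 (N - t0) | A t] <= B t0)%N ->
        `|\sum_(t0 <= t < N | A t) a t *: y t|
          <= (2 + eps) * `|\sum_(0 <= t < N) a t *: y t|].
Proof.
move=> eps0 c0 zb z0.
have [U [UU ooU]] := ultraFilterLemma (F := \oo : set_system nat) _.
(* [2 + eps = 1 + K + 2 e] splits [eps] between the basis constant and the two
   error terms of [restricted_sum_le]. *)
pose e := eps / 3; have e0 : 0 < e by rewrite divr_gt0.
pose K := 1 + e; have K1 : 1 < K by rewrite ltrDl.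
have K0 : 0 < K by lra.
pose eta t := e * c (r t) / (2 * K) * 2^-1 ^+ t.+1.
pose delta t := e * c (r t) / (4 * K * (B t).+1%:R).
have eta0 t : 0 < eta t.
  by rewrite /eta !(mulr_gt0, divr_gt0, exprn_gt0, invr_gt0).
have delta0 t : 0 < delta t by rewrite divr_gt0 ?mulr_gt0//.
have /choice[grid gridP] t := finite_grid (C (r t)) (delta0 t).
have z0U i f : dual_ball f -> f (z i n) @[n --> U] --> 0.
  by move=> fb A /(z0 i f fb); exact: ooU.
have zc i n : c i <= `|z i n| by case/andP: (zb i n).
have zC i n : `|z i n| <= C i by case/andP: (zb i n).
have [l [bl yK resp]] := selection r b ooU K1 eta0
  (finite_patterns z r B delta grid) c0 zc z0U.
exists l, K => y; split=> //; first exact: ltW.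
move=> a t0 N A Ar AB.
have -> : 2 + eps = 1 + K + 2 * e by rewrite /K /e; field.
apply: (restricted_sum_le (cy := fun t => c (r t)) (eta := eta)
  (delta := delta t0) a (ltW K1) e0 yK _ _ _ AB).
- by move=> t; rewrite c0 zc.
- by move=> t t0t At; rewrite Ar.
- by move=> t; exact: lexx.
- move=> f fb; exact: (pattern_transfer zC gridP resp fb Ar AB).
Qed.

End SchreierProjection.

(** * Arrays *)

Lemma rl_enum_inj : injective rl_enum.
Proof.
move=> m n mn; have irr p : rl_lt p p = false by rewrite /rl_lt !ltnn andbF.
by have [/rl_enum_lt|/rl_enum_lt|//] := ltngtP m n; rewrite mn irr.
Qed.

Lemma rl_lt_asym p q : rl_lt p q -> ~~ rl_lt q p.
Proof. by case: p q => [a b] [c d]; rewrite /rl_lt /=; lia. Qed.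

Lemma rl_enum_ltW m n : rl_lt (rl_enum m) (rl_enum n) -> (m < n)%N.
Proof.
have [//|/rl_enum_lt|->] := ltngtP m n; first by move/rl_lt_asym/negbTE->.
by rewrite /rl_lt !ltnn andbF.
Qed.

Lemma increasing_cvg_infty (h : nat -> nat) :
  (forall n, h n < h n.+1)%N -> h n @[n --> \oo] --> \oo.
Proof.
move=> hS A [N _ NA]; exists N => // n /= Nn; apply: NA => /=.
apply: leq_trans Nn _; elim: n => // n IHn; exact: leq_ltn_trans IHn (hS n).
Qed.

Lemma bounded_finite_set (T : choiceType) (A : set T) (h : T -> nat) :
  finite_set A -> exists N, forall p, A p -> (h p < N)%N.
Proof.
move=> /finite_fsetP[B ->]; exists (\max_(p <- enum_fset B) h p).+1 => p pB.
by rewrite ltnS; exact: leq_bigmax_seq.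
Qed.

Lemma fsum_array_index (R : realType) (X : normedModType R) (w : nat * nat -> X) N :
  (forall n, (N <= n)%N -> w (rl_enum n) = 0) ->
  \sum_(p \in array_index) w p = \sum_(0 <= n < N) w (rl_enum n).
Proof.
move=> w0; rewrite (@fsbigE _ _ _ _ _ [seq rl_enum n | n <- iota 0 N]).
- rewrite big_map /index_iota subn0; apply: eq_bigl => n.
  by rewrite mem_set//; exact: rl_enum_index.
- by rewrite map_inj_uniq ?iota_uniq//; exact: rl_enum_inj.
- by move=> p /= /mapP[n _ ->]; exact: rl_enum_index.
move=> p /rl_enum_surj[n <-]; rewrite (mem_map rl_enum_inj) mem_iota /= add0n.
by rewrite -leqNgt; exact: w0.
Qed.

Theorem theorem2p9 (R : realType) (X : completeNormedModType R)
    (x : nat * nat -> X) (M : nat -> nat) (eps : R) :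
  regular_array x ->
  {homo M : i j / (i <= j)%N} ->
  0 < eps ->
  exists y : nat * nat -> X,
    [/\ regular_array y,
        subarray x y &
        forall a : nat * nat -> R,
          finite_set (array_index `&` [set p | a p != 0]) ->
        forall (k0 : nat) (F : {fset nat}) (m : nat),
          is_min F m -> (#|` F| <= M m)%N -> (k0 <= m)%N ->
          (2 + eps)^-1 * `|\sum_(j <- F) a (k0, j) *: y (k0, j)|
            <= `|\sum_(p \in array_index) a p *: y p|].
Proof.
move=> [xarr _] _ eps0.
have /choice[c cP] i : exists c : R * R, 0 < c.1 /\
    forall n, c.1 <= `|array_row x i n| <= c.2.
  by have [[c [C [c0 cC]]] _] := xarr i; exists (c, C).
(* Column [n] of the [i]-th row sequence is the entry [(i, i + n)], so asking
   that [l] grow by more than [r t] makes the true columns [r t + l t]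
   increase. *)
pose r t := (rl_enum t).1.
have [|||l [K [lS K0 yK yF]]] := schreier_selection r (fun t => M (rl_enum t).2)
    (fun t n => (r t + n).+1) (c := fun i => (c i).1) (C := fun i => (c i).2) eps0
    (z := array_row x).
- by move=> i; have [] := cP i.
- by move=> i n; have [_] := cP i.
- by move=> i f; exact: (dual_ball_weakly_null (xarr i).2).
have /choice[time timeP] p : exists n, array_index p -> rl_enum n = p.
  have [/rl_enum_surj[n <-]|np] := pselect (array_index p); first by exists n.
  by exists 0%N.
have timeK n : time (rl_enum n) = n.
  by apply: rl_enum_inj; apply: timeP; exact: rl_enum_index.
have time_lt p q :
    array_index p -> array_index q -> rl_lt p q -> (time p < time q)%N.
  by move=> Ip Iq; rewrite -{1}(timeP p Ip) -{1}(timeP q Iq); exact: rl_enum_ltW.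
have l_mono : {homo l : s t / (s < t)%N}.
  apply: homo_ltn => [s t u|t]; first exact: ltn_trans.
  by apply: leq_trans (lS t); rewrite ltnS leq_addl.
have col_mono : {homo (fun t => r t + l t)%N : s t / (s < t)%N}.
  apply: homo_ltn => [s t u|t]; first exact: ltn_trans.
  by apply: leq_trans (lS t) _; exact: leq_addl.
pose H p := (p.1, p.1 + l (time p))%N.
pose y p := x (H p).
have yE t : y (rl_enum t) = array_row x (r t) (l t) by rewrite /y /H timeK.
have row_index i n : array_index (i, i + n)%N by rewrite /array_index /= leq_addr.
have yrow i :
    array_row y i = array_row x i \o (fun n => l (time (i, i + n)%N)) by [].
have time_row i n : (time (i, i + n) < time (i, i + n.+1))%N.
  by apply: time_lt; rewrite // /rl_lt /= addnS ltnS leqnn.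
have yarr : is_array y.
  move=> i; split.
    by exists (c i).1, (c i).2; have [c0 cb] := cP i; split=> // n; exact: cb.
  move=> f fc; rewrite yrow.
  apply: (cvg_comp _ _ (increasing_cvg_infty _) ((xarr i).2 f fc)) => n.
  by apply: l_mono; exact: time_row.
exists y; split.
- split=> //; apply: (basic_sequence_of_partial_sums K0) => n.
    by move: (yK n); congr (partial_sums_bounded _ K n); apply/funext => t.
  rewrite yE -normr_gt0; have [c0 cb] := cP (r n).
  by have /andP[+ _] := cb (l n); exact: lt_le_trans.
- split=> //.
    move=> i _ [j ij <-]; exists (i + l (time (i, j)))%N => //=.
    by rewrite leq_addr.
  exists H; split=> // [p _|p q Ip Iq pq]; first by rewrite /array_index /= leq_addr.
  have := col_mono _ _ (time_lt p q Ip Iq pq).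
  by rewrite /r !timeP// /rl_lt /= => ->.
move=> a afin k0 F m [mF mmin] Fm k0m.
have k0I j : j \in F -> array_index (k0, j).
  by move=> /mmin; exact: leq_trans.
have [N1 N1P] := bounded_finite_set time afin.
have [N2 N2P] := bounded_finite_set (fun j => time (k0, j)) (finite_fset F).
pose N := maxn N1 N2; pose a' t := a (rl_enum t); pose t0 := time (k0, m).
pose A t := (r t == k0) && ((rl_enum t).2 \in F).
have et0 : rl_enum t0 = (k0, m) by apply: timeP; exact: k0I.
have permF : perm_eq [seq t <- iota t0 (N - t0) | A t] [seq time (k0, j) | j <- F].
  apply: uniq_perm; first by rewrite filter_uniq ?iota_uniq.
    rewrite map_inj_in_uniq ?fset_uniq// => i j iF jF /(congr1 rl_enum).
    by rewrite !timeP; [case|exact: k0I..].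
  have t0N : (t0 < N)%N by rewrite leq_max N2P ?orbT.
  move=> t; rewrite mem_filter mem_iota subnKC ?(ltnW t0N)//.
  apply/idP/mapP => [/andP[/andP[/eqP rt tF] _]|[j jF ->]].
    by exists (rl_enum t).2 => //; rewrite -rt -surjective_pairing timeK.
  rewrite /A /r timeP ?eqxx; last exact: k0I.
  rewrite jF /= leq_max N2P// orbT andbT.
  have := mmin j jF; rewrite leq_eqVlt => /predU1P[<-//|mj].
  by apply: ltnW; apply: time_lt; [exact: k0I|exact: k0I|rewrite /rl_lt /= mj].
rewrite (fsum_array_index (N := N)); last first.
  move=> n Nn; apply/eqP; rewrite scaler_eq0; apply/orP; left.
  apply/negPn/negP => an; have := N1P (rl_enum n) (conj (rl_enum_index n) an).
  by rewrite timeK ltnNge (leq_trans _ Nn)// leq_maxl.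
have -> : \sum_(j <- F) a (k0, j) *: y (k0, j) =
    \sum_(t0 <= t < N | A t) a' t *: array_row x (r t) (l t).
  rewrite -[RHS]big_filter (perm_big _ permF) big_map big_seq [RHS]big_seq.
  by apply: eq_bigr => j jF; rewrite -yE /a' timeP//; exact: k0I.
have -> : \sum_(0 <= n < N) a (rl_enum n) *: y (rl_enum n) =
    \sum_(0 <= t < N) a' t *: array_row x (r t) (l t).
  by apply: eq_bigr => t _; rewrite yE.
rewrite ler_pdivrMl; last by rewrite addr_gt0.
apply: yF => [t _ /andP[/eqP-> _]|]; first by rewrite /r et0.
by rewrite (perm_size permF) size_map et0.
Qed.
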